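(* Let $X, X_1,X_2,\dots$ be i.i.d. nonnegative real random variables with distribution function $F$ and right endpoint $x^*>0$. Suppose that $\mathsf{E}[X]=\int_0^\infty x\,dF(x)<\infty$ and that $F\in\mathsf{MDA}(G_\xi)$ for some $\xi<1$. Suppose furthermore that $\xi\le0$ and $x^*<\infty$. Then $$\lim_{n\to\infty}\frac{\mathsf{E}[\Delta_{cn}(x)]}{\mathsf{E}[\Delta_n(x)]}=c^\xi,\qquad 0<x<x^*,\ c\in\mathbb{N},$$ $$\lim_{n\to\infty}\frac{\log\mathsf{E}[\Delta_n(x)]}{\log n}=\xi,\qquad 0<x<x^*.$$
   Context: Notation. $\mathbb{N}=\{1,2,\dots\}$, $\mathbb{R}_+=[0,\infty)$, $(y)_+=\max(y,0)$. $F(x)=\mathsf{P}(X\le x)$ and $x^*=\sup\{x\in\mathbb{R}_+:F(x)<1\}$, assumed positive. $Z_n=\max(X_1,\dots,X_n)$. For $x^*<\infty$, $0<x<x^*$ and $n\in\mathbb{N}$, $$\Delta_n(x)=\frac{x^*-\max(Z_n,x)}{x^*}.$$ $G_\xi(z)=\exp\{-(1+\xi z)_+^{-1/\xi}\}$, $z\in\mathbb{R}$, is the standard generalized extreme value distribution, with $(1+\xi z)_+^{-1/\xi}$ interpreted as $e^{-z}$ if $\xi=0$. $F\in\mathsf{MDA}(G)$ means that there exist constants $a_n>0$, $b_n\in\mathbb{R}$ such that $\lim_{n\to\infty}\mathsf{P}((Z_n-b_n)/a_n\le z)=\lim_{n\to\infty}[F(a_nz+b_n)]^n=G(z)$ for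 every continuity point $z$ of $G$. *)

(* Defs.v *)
From HB Require Import structures.
From mathcomp Require Export all_boot all_order all_algebra.
From mathcomp Require Export all_classical all_reals all_analysis.
Export Order.TTheory GRing.Theory Num.Theory.
Export numFieldNormedType.Exports.

#[global] Set Implicit Arguments.
#[global] Unset Strict Implicit.
#[global] Unset Printing Implicit Defensive.

Local Open Scope classical_set_scope.
Local Open Scope ring_scope.

Definition mutually_independent d (T : measurableType d) (R : realType)
    (P : probability T R) (X : nat -> {RV P >-> R}) : Prop :=
  forall (J : seq nat) (A : nat -> set R), uniq J ->
    (forall i, measurable (A i)) ->
    P (\bigcap_(i in [set` J]) (X i @^-1` A i)) =
      (\prod_(i <- J) P (X i @^-1` A i))%E.

Definition identically_distributed d (T : measurableType d) (R : realType)
    (P : probability T R) (X : nat -> {RV P >-> R}) : Prop :=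
  forall (i j : nat) (A : set R), measurable A ->
    distribution P (X i) A = distribution P (X j) A.

(* The library's [cdf] takes its values in [\bar R]. *)
Definition distribution_function d (T : measurableType d) (R : realType)
    (P : probability T R) (X : {RV P >-> R}) (x : R) : R :=
  fine (cdf X x).

Definition right_endpoint (R : realType) (F : R -> R) : \bar R :=
  ereal_sup [set x%:E | x in [set x : R | 0 <= x /\ F x < 1]].

(* [0 `^ p = 0] for every [p != 0], also for [p < 0]: the case [0 < xi],
   [1 + xi * z <= 0], where the power is [+oo], needs its own branch. *)
Definition gev (R : realType) (xi z : R) : R :=
  if xi == 0 then expR (- expR (- z))
  else if (0 < xi) && (1 + xi * z <= 0) then 0
  else expR (- (Num.max (1 + xi * z) 0 `^ (- xi^-1))).

Definition MDA (R : realType) (F G : R -> R) : Prop :=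
  exists a b : nat -> R, (forall n, 0 < a n) /\
    forall z : R, {for z, continuous G} ->
      F (a n * z + b n) ^+ n @[n --> \oo] --> G z.

(* The maximum of [X 1, ..., X n] for [0 < n]; [X 0] does not take part, and
   the value at [n = 0] is junk. *)
Definition sample_max (T : Type) (R : realType) (X : nat -> T -> R)
    (n : nat) (w : T) : R :=
  \big[Num.max/X 1%N w]_(1 <= i < n.+1) X i w.

Definition Delta (T : Type) (R : realType) (X : nat -> T -> R) (xstar : R)
    (n : nat) (x : R) (w : T) : R :=
  (xstar - Num.max (sample_max X n w) x) / xstar.

(* Main.v *)
Require Import Defs.
From mathcomp Require Import measurable_realfun ring lra.
Local Open Scope classical_set_scope.
Local Open Scope ring_scope.

(** Write xstar for the right endpoint and Y_n for the positive part of
    [xstar - max (Z_n, x)].  Almost surely [Delta X xstar n x = Y_n / xstar],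
    and for [0 <= r < xstar - x] the tail of Y_n at r is
    P(X < xstar - r)^n.  Everything therefore depends on how the distribution
    function behaves just below the endpoint, and what is needed of it is a
    comparison under dilation: as u decreases to 0,

      [F (xstar - u) <= F (xstar - lam * u) ^+ c]   if [lam < c `^ xi],
      [F (xstar - lam * u) ^+ c <= F (xstar - u)]   if [c `^ xi < lam]

    ([cdf_le_dilated_power], [dilated_power_le_cdf]).  This is regular
    variation of the quantile function at the endpoint, in a form that treats
    the Weibull case [xi < 0] and the Gumbel case [xi = 0] alike.

    To get it from the domain of attraction, let [gev_level xi tau] be the
    point where the limit law takes the value exp(-tau), and let
    [gap tau n] be the distance from the endpoint to
    [a n * gev_level xi tau + b n], so that
    F(xstar - gap tau n)^n tends to exp(-tau).  Comparing the indices n and 2n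
    and using that F is monotone places [gap tau (2 * n)] between
    [gap sigma n] for sigma slightly below and slightly above [tau / 2].
    Consequently, for [lam * rho `^ (- xi) < lam' * rho' `^ (- xi)], the
    sequence [w n = lam' * gap rho' n - lam * gap rho n] does not increase from
    n to 2n for large n, and it tends to 0 because the endpoint is finite; so
    it is eventually nonnegative ([le_scaled_gap]).  This replaces the
    convergence of types theorem and the asymptotics of [a n] and [b n].  A
    small u lies between two consecutive values of [gap 1], which transfers the
    comparison from the gaps to all small u.

    By the layer-cake formula the dilation inequalities say that, up to
    truncation, Y_{cn} lies between [lam * Y_n] and [lam' * Y_n] in the
    stochastic order, for every lam below and lam' above [c `^ xi].  The
    truncation costs a geometric sequence of ratio P(X < xstar - delta),
    which is negligible because E[Y_n] is bounded below by geometric sequences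
    of ratios arbitrarily close to 1 ([geometric_negligible]).  This gives the
    first limit.  The second one follows from the case [c = 2], the
    monotonicity in n, and Cesaro means along the powers of 2
    ([cvg_log_rate]). *)

(** * Limits of powers *)

Lemma continuous_powR (R : realType) (p x : R) :
  0 < x -> {for x, continuous (fun y : R => y `^ p)}.
Proof.
move=> x0; apply: differentiable_continuous; apply/derivable1_diffP.
by apply: derivable_powR; rewrite in_itv/= x0.
Qed.

Lemma cvg_comp_muln (U : topologicalType) (u : nat -> U) (l : U) (m : nat) :
  (0 < m)%N -> u n @[n --> \oo] --> l -> u (m * n)%N @[n --> \oo] --> l.
Proof.
move=> m0 ul; apply: (cvg_comp _ _ _ ul).
move=> A [N _ NA]; exists N => // n /= Nn; apply: NA => /=.
by rewrite (leq_trans Nn)// leq_pmull.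
Qed.

(** A base bounded away from 1 infinitely often would have powers arbitrarily
    close to 0. *)
Lemma cvg1_of_expn_cvg (R : realType) (u : nat -> R) (l : R) :
  (forall n, 0 <= u n <= 1) -> 0 < l ->
  u n ^+ n @[n --> \oo] --> l -> u n @[n --> \oo] --> (1 : R).
Proof.
move=> u01 l0 ul; apply/cvgrPdist_lt => /= e e0.
pose r := Num.max 0 (1 - e / 2).
have r01 : `|r| < 1.
  rewrite ger0_norm ?le_max ?lexx// gt_max ltr01 /=; lra.
have rl := cvg_expr r01.
near=> n.
have u01n := u01 n.
rewrite ger0_norm; last lra.
suff : r < u n.
  have : 1 - e / 2 <= r by rewrite le_max lexx orbT.
  lra.
rewrite ltNge; apply/negP => un_r.
have /andP[un0 _] := u01n.
have : u n ^+ n <= r ^+ n by rewrite lerXn2r ?nnegrE ?(le_trans un0 un_r).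
apply/negP; rewrite -ltNge (@lt_trans _ _ (l / 2))//.
  near: n; apply: (cvgr_lt _ rl); lra.
near: n; apply: (cvgr_gt _ ul); lra.
Unshelve. all: by end_near. Qed.

(** * Levels of the limit law *)

(** For [0 < tau], the (exp(-tau))-quantile of the limit law. *)
Definition gev_level (R : realType) (xi tau : R) : R :=
  if xi == 0 then - ln tau else (tau `^ (- xi) - 1) / xi.

Section gev_level.
Variables (R : realType) (xi : R).
Hypothesis xi_le0 : xi <= 0.

Lemma gev_gev_level (tau : R) : 0 < tau ->
  gev xi (gev_level xi tau) = expR (- tau).
Proof.
move=> tau0; rewrite /gev /gev_level; case: eqP => [xi0|/eqP xi0].
  by rewrite opprK lnK.
rewrite ltNge xi_le0 /= mulrC divfK// addrC subrK.
rewrite max_l ?powR_ge0// -powRrM mulrNN divff// powRr1// ltW//.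
Qed.

Lemma continuous_gev_level (tau : R) : 0 < tau ->
  {for tau, continuous (gev_level xi)}.
Proof.
move=> tau0; have [->|xi0] := eqVneq xi 0.
  rewrite /gev_level eqxx.
  by apply: (@continuousN _ R^o); exact: continuous_ln.
rewrite /gev_level (negPf xi0).
apply: (@continuousM _ _ (fun t : R => t `^ (- xi) - 1) (fun=> xi^-1)).
  apply: (@continuousB _ R^o _ (fun t : R => t `^ (- xi)) (fun=> 1)).
    exact: continuous_powR.
  exact: cst_continuous.
exact: cst_continuous.
Qed.

Lemma continuous_gev_at_level (tau : R) : 0 < tau ->
  {for gev_level xi tau, continuous (gev xi)}.
Proof.
move=> tau0; rewrite /gev /gev_level; have [xi0|xi0] := eqVneq xi 0.
  apply: (@continuous_comp _ _ _ (fun z : R => - expR (- z)) expR);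
    last exact: continuous_expR.
  apply: (@continuousN _ R^o _ (fun z : R => expR (- z))).
  apply: (@continuous_comp _ _ _ -%R expR); last exact: continuous_expR.
  exact: oppr_continuous.
rewrite ltNge xi_le0 /=.
set z := (_ / xi).
have zE : Num.max (1 + xi * z) 0 = tau `^ (- xi).
  by rewrite /z mulrC divfK// addrC subrK max_l ?powR_ge0.
apply: (@continuous_comp _ _ _
  (fun y => - Num.max (1 + xi * y) 0 `^ (- xi^-1)) expR);
  last exact: continuous_expR.
apply: (@continuousN _ R^o _ (fun y => Num.max (1 + xi * y) 0 `^ (- xi^-1))).
apply: (@continuous_comp _ _ _ (fun y => Num.max (1 + xi * y) 0)
  (fun t : R => t `^ (- xi^-1))); last first.
  by apply: continuous_powR; rewrite zE powR_gt0.
apply: (@continuous_max _ _ (fun y : R => 1 + xi * y) (fun=> 0));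
  last exact: cst_continuous.
apply: (@continuousD _ R^o _ (fun=> 1) (fun y : R => xi * y)).
  exact: cst_continuous.
exact: mulrl_continuous.
Qed.

Lemma gev_level_half_gt0 : 0 < gev_level xi 2^-1.
Proof.
rewrite /gev_level; case: eqP => [xi0|/eqP xi0].
  by rewrite oppr_gt0 ln_lt0//; lra.
have xi_lt0 : xi < 0 by rewrite lt_neqAle xi0.
rewrite nmulr_lgt0 ?invr_lt0// subr_lt0.
have := @gt0_ltr_powR R (- xi) _ 2^-1 1.
rewrite powR1; apply; rewrite ?nnegrE; lra.
Qed.

(** Replacing tau by [tau / 2] shifts the level by an amount which, relative to
    the shift at [tau = 1], is the power [tau `^ (- xi)], also when [xi = 0].
    This identity is where the exponent of the theorem comes from. *)
Lemma gev_level_halve (tau : R) : 0 < tau ->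
  gev_level xi (tau / 2) - gev_level xi tau =
  tau `^ (- xi) * gev_level xi 2^-1.
Proof.
move=> tau0; rewrite /gev_level; case: eqP => [->|/eqP xi0].
  by rewrite oppr0 powRr0 mul1r lnM ?posrE ?invr_gt0//; ring.
by rewrite powRM ?invr_ge0 ?ltW//; field.
Qed.

End gev_level.

(** * Attraction at a finite endpoint *)

Section endpoint_attraction.
Variables (R : realType) (F : R -> R) (xstar xi : R) (a b : nat -> R).
Hypothesis xi_le0 : xi <= 0.
Hypothesis a_gt0 : forall n, 0 < a n.
Hypothesis F_nd : {homo F : s t / s <= t}.
Hypothesis F01 : forall t, 0 <= F t <= 1.
Hypothesis F_lt1 : forall t, t < xstar -> F t < 1.
Hypothesis F_eq1 : F xstar = 1.
Hypothesis F_cvg : forall z : R, {for z, continuous (gev xi)} ->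
  F (a n * z + b n) ^+ n @[n --> \oo] --> gev xi z.

(** Signed distance from the endpoint to the approximate (exp(-tau))-quantile
    of the maximum of n observations. *)
Definition gap (tau : R) (n : nat) : R :=
  xstar - (a n * gev_level xi tau + b n).

Lemma gapB (sigma tau : R) (n : nat) :
  gap sigma n - gap tau n = a n * (gev_level xi tau - gev_level xi sigma).
Proof. by rewrite /gap; ring. Qed.

Lemma F_gap_expn_cvg (tau : R) : 0 < tau ->
  F (xstar - gap tau n) ^+ n @[n --> \oo] --> expR (- tau).
Proof.
move=> tau0; rewrite -(gev_gev_level xi_le0)//.
under eq_cvg do rewrite /gap opprB addrC subrK.
by apply: F_cvg; exact: continuous_gev_at_level.
Qed.

Lemma F_gap_cvg1 (tau : R) : 0 < tau ->
  F (xstar - gap tau n) @[n --> \oo] --> (1 : R).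
Proof.
move=> tau0; apply: (@cvg1_of_expn_cvg _ _ (expR (- tau))) => //.
- exact: expR_gt0.
- exact: F_gap_expn_cvg.
Qed.

Lemma F_gap_expnM_cvg (m : nat) (tau : R) : 0 < tau ->
  F (xstar - gap tau n) ^+ (m * n) @[n --> \oo] --> expR (- (m%:R * tau)).
Proof.
move=> tau0; rewrite -mulrN -mulr_natl mulr_natl expRM_natl.
under eq_cvg do rewrite mulnC exprM.
exact: (cvg_comp _ _ (F_gap_expn_cvg tau0) (@exprn_continuous _ m _)).
Qed.

(** Points are compared through the limits of powers of F at these points; as F
    is monotone, this stands in for inverting it. *)
Lemma lt_of_F_expn_cvg (u v : nat -> R) (k : nat -> nat) (l l' : R) :
  l < l' ->
  F (xstar - u n) ^+ k n @[n --> \oo] --> l ->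
  F (xstar - v n) ^+ k n @[n --> \oo] --> l' ->
  \forall n \near \oo, v n < u n.
Proof.
move=> ll' ul vl'; near=> n.
rewrite ltNge; apply/negP => uv.
have : F (xstar - v n) ^+ k n <= F (xstar - u n) ^+ k n.
  rewrite lerXn2r ?nnegrE//.
  - by case/andP: (F01 (xstar - v n)).
  - by case/andP: (F01 (xstar - u n)).
  - by apply: F_nd; rewrite lerD2l lerN2.
apply/negP; rewrite -ltNge; apply: (@lt_trans _ _ ((l + l') / 2)).
  by near: n; apply: (cvgr_lt _ ul); lra.
by near: n; apply: (cvgr_gt _ vl'); lra.
Unshelve. all: by end_near. Qed.

Lemma F_gap_double_cvg (tau : R) : 0 < tau ->
  F (xstar - gap tau (2 * n)) ^+ (2 * n) @[n --> \oo] --> expR (- tau).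
Proof.
move=> tau0.
apply: (@cvg_comp_muln _ (fun n => F (xstar - gap tau n) ^+ n)) => //.
exact: F_gap_expn_cvg.
Qed.

(** The event that 2n observations stay below a point has the square of the
    probability for n observations, so index 2n with level tau corresponds to
    index n with level [tau / 2]. *)
Lemma gap_lt_double (sigma tau : R) : 0 < sigma -> sigma < tau / 2 ->
  \forall n \near \oo, gap sigma n < gap tau (2 * n).
Proof.
move=> s0 st.
apply: (lt_of_F_expn_cvg _ (@F_gap_double_cvg tau _)
  (@F_gap_expnM_cvg 2 sigma _)) => //.
  by rewrite ltr_expR; lra.
by lra.
Qed.

Lemma gap_double_lt (sigma tau : R) : 0 < tau -> tau / 2 < sigma ->
  \forall n \near \oo, gap tau (2 * n) < gap sigma n.
Proof.
move=> t0 ts.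
apply: (lt_of_F_expn_cvg _ (@F_gap_expnM_cvg 2 sigma _)
  (@F_gap_double_cvg tau _)) => //.
  by rewrite ltr_expR; lra.
by lra.
Qed.

(** At or above the endpoint F is 1, and so are its powers, whereas
    exp(-tau) < 1. *)
Lemma gap_gt0 (tau : R) : 0 < tau -> \forall n \near \oo, 0 < gap tau n.
Proof.
move=> tau0; near=> n.
rewrite ltNge; apply/negP => g0.
have : F (xstar - gap tau n) = 1.
  apply/eqP; rewrite eq_le; case/andP: (F01 (xstar - gap tau n)) => _ -> /=.
  by rewrite -{1}F_eq1; apply: F_nd; lra.
move=> F1; have : F (xstar - gap tau n) ^+ n < 1.
  near: n; apply: (cvgr_lt _ (F_gap_expn_cvg tau0)).
  by rewrite -[ltRHS]expR0 ltr_expR; lra.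
by rewrite F1 expr1n ltxx.
Unshelve. all: by end_near. Qed.

Lemma gap_cvg0 (tau : R) : 0 < tau -> gap tau n @[n --> \oo] --> (0 : R).
Proof.
move=> tau0; apply/cvgrPdist_lt => /= e e0.
have Fe : F (xstar - e) < 1 by apply: F_lt1; lra.
near=> n.
have g0 : 0 < gap tau n by near: n; exact: gap_gt0.
rewrite sub0r normrN gtr0_norm// ltNge; apply/negP => eg.
have : F (xstar - gap tau n) <= F (xstar - e) by apply: F_nd; lra.
by apply/negP; rewrite -ltNge; near: n; apply: (cvgr_gt _ (F_gap_cvg1 tau0)).
Unshelve. all: by end_near. Qed.

(** For large n the subsequence at n, 2n, 4n, ... is nonincreasing, so it stays
    above its limit 0. *)
Lemma ge0_of_halving (w : nat -> R) : w n @[n --> \oo] --> (0 : R) ->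
  (\forall n \near \oo, w (2 * n)%N <= w n) -> \forall n \near \oo, 0 <= w n.
Proof.
move=> w0 [N _ wN]; exists N.+1 => // n /= Nn.
have wnk k : w (2 ^ k * n)%N <= w n.
  elim: k => [|k IHk]; first by rewrite mul1n.
  apply: le_trans IHk; rewrite expnS -mulnA; apply: wN => /=.
  by rewrite (leq_trans (ltnW Nn))// leq_pmull// expn_gt0.
rewrite leNgt; apply/negP => wn0.
move/cvgrPdist_lt : w0 => /(_ (- w n)); rewrite oppr_gt0 => /(_ wn0)[M _ wM].
have /wM : (M <= 2 ^ M * n)%N.
  rewrite (leq_trans (ltnW (ltn_expl M (ltnSn 1))))// leq_pmulr//.
  by rewrite (leq_trans _ Nn).
rewrite sub0r normrN => /ltr_normlP[]; have := wnk M; lra.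
Qed.

(** The difference w of the two sides satisfies
    [w n - w (2 * n) = a n * (drift + o(1))], where by [gev_level_halve] the
    drift is [gev_level xi 2^-1] times
    [lam' * rho' `^ (- xi) - lam * rho `^ (- xi)], a positive number.  Hence
    [ge0_of_halving] applies. *)
Lemma le_scaled_gap (lam lam' rho rho' : R) :
  0 < lam -> 0 < lam' -> 0 < rho -> 0 < rho' ->
  lam * rho `^ (- xi) < lam' * rho' `^ (- xi) ->
  \forall n \near \oo, lam * gap rho n <= lam' * gap rho' n.
Proof.
move=> lam0 lam'0 rho0 rho'0 lt_lam.
(* The levels at index [2 * n] are only known up to a factor kappa that can be
   taken arbitrarily close to 1; [drift 1] is the exact drift. *)
pose drift kappa :=
  lam' * (gev_level xi (kappa * (rho' / 2)) - gev_level xi rho') -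
  lam * (gev_level xi (kappa^-1 * (rho / 2)) - gev_level xi rho).
have drift1 : 0 < drift 1.
  rewrite /drift invr1 !mul1r !gev_level_halve//.
  rewrite !mulrA -mulrBl mulr_gt0 ?gev_level_half_gt0//.
  by rewrite subr_gt0.
have drift_cont : {for 1, continuous drift}.
  apply: (@continuousB _ R^o).
    apply: (@continuousM _ _ (fun=> lam')); first exact: cst_continuous.
    apply: (@continuousB _ R^o _ _ (fun=> gev_level xi rho'));
      last exact: cst_continuous.
    apply: (@continuous_comp R R R (fun k : R => k * (rho' / 2))
      (gev_level xi)).
      exact: mulrr_continuous.
    by apply: continuous_gev_level => //; lra.
  apply: (@continuousM _ _ (fun=> lam)); first exact: cst_continuous.
  apply: (@continuousB _ R^o _ _ (fun=> gev_level xi rho));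
    last exact: cst_continuous.
  apply: (@continuous_comp R R R (fun k : R => k^-1 * (rho / 2))
    (gev_level xi)).
    apply: (@continuousM _ _ (fun k : R => k^-1)); last exact: cst_continuous.
    by apply: (@continuousV _ _ id) => //; exact: oner_neq0.
  by apply: continuous_gev_level => //; rewrite invr1; lra.
have [kappa [kappa1 drift0]] : exists kappa, 1 < kappa /\ 0 < drift kappa.
  near (1 : R)^'+ => kappa; exists kappa; split.
    by near: kappa; exact: nbhs_right_gt.
  by near: kappa; apply: (cvgr_gt _ (cvg_at_right_filter drift_cont)).
have kappaV : 0 < kappa^-1 < 1.
  by rewrite invr_gt0 invf_lt1; lra.
pose w n := lam' * gap rho' n - lam * gap rho n.
suff : \forall n \near \oo, 0 <= w n.
  by apply: filterS => n; rewrite subr_ge0.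
apply: ge0_of_halving.
  rewrite -[0 in X in _ --> X](_ : lam' * 0 - lam * 0 = 0); last by ring.
  apply: (@cvgB _ R^o); apply: (@cvgM); try exact: cvg_cst; exact: gap_cvg0.
near=> n.
have g' : gap rho' (2 * n) < gap (kappa * (rho' / 2)) n.
  by near: n; apply: gap_double_lt => //; nra.
have g : gap (kappa^-1 * (rho / 2)) n < gap rho (2 * n).
  by near: n; apply: gap_lt_double; nra.
have : 0 < a n * drift kappa by rewrite mulr_gt0.
have := gapB rho' (kappa * (rho' / 2)) n.
have := gapB rho (kappa^-1 * (rho / 2)) n.
rewrite /w /drift => e1 e2.
rewrite mulrBr mulrCA -e2 [a n * (lam * _)]mulrCA -e1.
nra.
Unshelve. all: by end_near. Qed.



(** Take the first n after N with [gap 1 n <= u]; the sequence [gap 1] itself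
    need not be monotone. *)
Lemma between_consecutive_gaps (N : nat) (u : R) : 0 < u -> u < gap 1 N ->
  exists2 n, (N <= n)%N & gap 1 n.+1 <= u < gap 1 n.
Proof.
move=> u0 uN.
have small : exists m, gap 1 (N + m) <= u.
  have [M _ uM] : \forall n \near \oo, gap 1 n < u.
    by apply: (cvgr_lt _ (gap_cvg0 _)).
  by exists M; apply/ltW/uM; rewrite /= leq_addl.
case: (ex_minnP small) => -[|m] gapm min_m.
  by move: gapm; rewrite addn0; lra.
exists (N + m)%N; first exact: leq_addr.
rewrite -addnS gapm /= ltNge; apply/negP => /min_m.
by rewrite ltnn.
Qed.

Lemma le_of_expn_cvg (u v : nat -> R) (l l' : R) :
  (forall n, 0 <= u n) -> (forall n, 0 <= v n) -> l < l' ->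
  u n ^+ n.+1 @[n --> \oo] --> l -> v n ^+ n.+1 @[n --> \oo] --> l' ->
  \forall n \near \oo, u n <= v n.
Proof.
move=> u0 v0 ll' ul vl'; near=> n.
rewrite leNgt; apply/negP => /ltW vu.
have : v n ^+ n.+1 <= u n ^+ n.+1 by rewrite lerXn2r ?nnegrE.
apply/negP; rewrite -ltNge; apply: (@lt_trans _ _ ((l + l') / 2)).
  by near: n; apply: (cvgr_lt _ ul); lra.
by near: n; apply: (cvgr_gt _ vl'); lra.
Unshelve. all: by end_near. Qed.

Lemma F_gap_expn_succ_cvg (c : nat) (tau : R) : 0 < tau ->
  (F (xstar - gap tau n) ^+ c) ^+ n.+1 @[n --> \oo] --> expR (- (c%:R * tau)).
Proof.
move=> tau0.
have base : F (xstar - gap tau n) ^+ c @[n --> \oo] --> (1 : R) ^+ c.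
  exact: (cvg_comp _ _ (F_gap_cvg1 tau0) (@exprn_continuous _ c _)).
rewrite -[expR _]mul1r -{1}(expr1n R c).
have -> : (fun n => (F (xstar - gap tau n) ^+ c) ^+ n.+1) =
    (fun n => F (xstar - gap tau n) ^+ c) \*
    (fun n => F (xstar - gap tau n) ^+ (c * n)).
  by apply/funext => n /=; rewrite exprS exprM.
exact: cvgM base (@F_gap_expnM_cvg c tau tau0).
Qed.

Lemma F_gap_succ_expn_cvg (c : nat) (tau : R) : 0 < tau ->
  (F (xstar - gap tau n.+1) ^+ c) ^+ n.+1 @[n --> \oo] -->
    expR (- (c%:R * tau)).
Proof.
move=> tau0; rewrite (cvg_shiftS (fun n => (F (xstar - gap tau n) ^+ c) ^+ n)).
by under eq_cvg do rewrite -exprM; exact: F_gap_expnM_cvg.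
Qed.

Lemma F_le (s t : R) : t <= s -> F (xstar - s) <= F (xstar - t).
Proof. by move=> ts; apply: F_nd; rewrite lerD2l lerN2. Qed.

Lemma F_expn_le (c : nat) (s t : R) : t <= s ->
  F (xstar - s) ^+ c <= F (xstar - t) ^+ c.
Proof.
move=> ts; rewrite lerXn2r ?F_le// ?nnegrE.
- by case/andP: (F01 (xstar - s)).
- by case/andP: (F01 (xstar - t)).
Qed.

Lemma invn_powRN (c : nat) : (c%:R^-1 : R) `^ (- xi) = c%:R `^ xi.
Proof. by rewrite -powR_inv1// -powRrM mulN1r opprK. Qed.

(** With u between [gap 1 n.+1] and [gap 1 n], the left side is at most
    F(xstar - gap 1 n.+1), whose power n+1 tends to exp(-1), and the right side
    is at least F(xstar - gap rho n)^c, whose power n+1 tends to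
    exp(- c * rho).  The condition on lam leaves room for some [rho < c^-1]
    with [lam * gap 1 n <= gap rho n]. *)
Lemma cdf_le_dilated_power (c : nat) (lam : R) :
  (0 < c)%N -> 0 < lam < c%:R `^ xi ->
  exists2 delta, 0 < delta &
    forall u, 0 < u < delta -> F (xstar - u) <= F (xstar - lam * u) ^+ c.
Proof.
move=> c0 /andP[lam0 lamc].
have c0R : (0 : R) < c%:R by rewrite ltr0n.
have cV0 : (0 : R) < c%:R^-1 by rewrite invr_gt0.
have [rho [rho0 rhoc lam_rho]] :
    exists rho, [/\ 0 < rho, rho < c%:R^-1 & lam < rho `^ (- xi)].
  near (c%:R^-1 : R)^'- => rho; exists rho; split.
  - by near: rho; exact: nbhs_left_gt.
  - by near: rho; exact: nbhs_left_lt.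
  - near: rho; apply: (cvgr_gt _
      (cvg_at_left_filter (@continuous_powR R (- xi) _ cV0))).
    by rewrite invn_powRN.
have [N _ HN] : \forall n \near \oo, [/\ 0 < gap 1 n,
    lam * gap 1 n <= gap rho n &
    F (xstar - gap 1 n.+1) ^+ 1 <= F (xstar - gap rho n) ^+ c].
  near=> n; split; near: n.
  - exact: gap_gt0.
  - have := @le_scaled_gap lam 1 1 rho.
    rewrite powR1 mulr1 mul1r => /(_ lam0 ltr01 ltr01 rho0 lam_rho).
    by apply: filterS => n; rewrite mul1r.
  - apply: (le_of_expn_cvg _ _ _ (@F_gap_succ_expn_cvg 1 1 ltr01)
      (@F_gap_expn_succ_cvg c rho rho0)) => //.
    + by move=> n; rewrite exprn_ge0//; case/andP: (F01 (xstar - gap 1 n.+1)).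
    + by move=> n; rewrite exprn_ge0//; case/andP: (F01 (xstar - gap rho n)).
    + by rewrite ltr_expR ltrN2 mulr1 mulrC -ltr_pdivlMr// div1r.
exists (gap 1 N); first by have [] := HN N (leqnn N).
move=> u /andP[u0 /(between_consecutive_gaps u0)[n Nn /andP[gu ug]]].
have [_ gap_rho powers] := HN n Nn.
apply: le_trans (F_le gu) _; rewrite -[leLHS]expr1; apply: le_trans powers _.
apply: F_expn_le; apply: le_trans gap_rho.
by rewrite ler_pM2l// ltW.
Unshelve. all: by end_near. Qed.

(** The same argument with [rho > c^-1] and the roles of [gap 1 n] and
    [gap 1 n.+1] exchanged. *)
Lemma dilated_power_le_cdf (c : nat) (lam : R) :
  (0 < c)%N -> c%:R `^ xi < lam ->
  exists2 delta, 0 < delta &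
    forall u, 0 < u < delta -> F (xstar - lam * u) ^+ c <= F (xstar - u).
Proof.
move=> c0 lamc.
have lam0 : 0 < lam by apply: le_lt_trans lamc; exact: powR_ge0.
have c0R : (0 : R) < c%:R by rewrite ltr0n.
have cV0 : (0 : R) < c%:R^-1 by rewrite invr_gt0.
have [rho [rho0 rhoc lam_rho]] :
    exists rho, [/\ 0 < rho, c%:R^-1 < rho & rho `^ (- xi) < lam].
  near (c%:R^-1 : R)^'+ => rho.
  have rhoc : c%:R^-1 < rho by near: rho; exact: nbhs_right_gt.
  exists rho; split; [exact: lt_trans rhoc|exact: rhoc|].
  near: rho; apply: (cvgr_lt _
    (cvg_at_right_filter (@continuous_powR R (- xi) _ cV0))).
  by rewrite invn_powRN.
have [N _ HN] : \forall n \near \oo, [/\ 0 < gap 1 n,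
    gap rho n.+1 <= lam * gap 1 n.+1 &
    F (xstar - gap rho n.+1) ^+ c <= F (xstar - gap 1 n) ^+ 1].
  near=> n; split; near: n.
  - exact: gap_gt0.
  - have := @le_scaled_gap 1 lam rho 1.
    rewrite powR1 mulr1 mul1r => /(_ ltr01 lam0 rho0 ltr01 lam_rho).
    case=> M _ HM; exists M => // n Mn.
    by rewrite -[leLHS]mul1r HM//=; exact: leqW.
  - apply: (le_of_expn_cvg _ _ _ (@F_gap_succ_expn_cvg c rho rho0)
      (@F_gap_expn_succ_cvg 1 1 ltr01)) => //.
    + by move=> n; rewrite exprn_ge0//; case/andP: (F01 (xstar - gap rho n.+1)).
    + by move=> n; rewrite exprn_ge0//; case/andP: (F01 (xstar - gap 1 n)).
    + by rewrite ltr_expR ltrN2 mulr1 mulrC -ltr_pdivrMr// div1r.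
exists (gap 1 N); first by have [] := HN N (leqnn N).
move=> u /andP[u0 /(between_consecutive_gaps u0)[n Nn /andP[gu ug]]].
have [_ gap_rho powers] := HN n Nn.
apply: le_trans (F_le (ltW ug)); rewrite -[leRHS]expr1; apply: le_trans powers.
apply: F_expn_le; apply: (le_trans gap_rho).
by rewrite ler_pM2l.
Unshelve. all: by end_near. Qed.

Lemma cdf_close_to_1 (y : R) : y < 1 ->
  exists2 eta, 0 < eta & y < F (xstar - eta).
Proof.
move=> y1; near \oo => n; exists (gap 1 n).
  by near: n; exact: gap_gt0.
by near: n; apply: (cvgr_gt _ (F_gap_cvg1 ltr01)).
Unshelve. all: by end_near. Qed.

End endpoint_attraction.

(** * Logarithmic rate of a monotone sequence *)

Lemma cvg_mean_of_increments (R : realType) (w : nat -> R) (l : R) :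
  w k.+1 - w k @[k --> \oo] --> l -> w k / k%:R @[k --> \oo] --> l.
Proof.
move=> /cesaro wl; rewrite -(cvg_shiftS (fun k => w k / k%:R)).
have -> : (fun k => w k.+1 / k.+1%:R) =
    (fun k => arithmetic_mean (fun k => w k.+1 - w k) k + w 0 * k.+1%:R^-1).
  apply/funext => k; rewrite /arithmetic_mean /= /series /= telescope_sumr//.
  by rewrite mulrC mulrBr; ring.
rewrite -[l]addr0 -[X in _ --> _ + X](mulr0 (w 0)).
apply: (@cvgD _ R^o) => //; apply: (@cvgM) => //; first exact: cvg_cst.
exact: cvg_harmonic.
Qed.

Lemma trunc_log_cvgy (p : nat) : (1 < p)%N -> trunc_log p n @[n --> \oo] --> \oo.
Proof.
move=> p1 A [N _ NA]; exists (p ^ N)%N => // n /= Nn; apply: NA => /=.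
exact: trunc_log_max.
Qed.

Lemma cvg_invn (R : realType) : (k%:R^-1 : R) @[k --> \oo] --> (0 : R).
Proof.
by rewrite -(cvg_shiftS (fun k => (k%:R^-1 : R))); exact: cvg_harmonic.
Qed.

Lemma cvg_trunc_log_ln (R : realType) :
  ((trunc_log 2 n)%:R / ln n%:R : R) @[n --> \oo] --> ((ln 2)^-1 : R).
Proof.
have ln2_gt0 : (0 : R) < ln 2 by apply: ln_gt0; lra.
have lower : ((1 - (trunc_log 2 n).+1%:R^-1) / ln 2 : R) @[n --> \oo] -->
    ((ln 2)^-1 : R).
  have := cvg_comp _ _ (trunc_log_cvgy (ltnSn 1)) (@cvg_harmonic R).
  move=> /(cvgB (cvg_cst (1 : R^o))) h.
  have := cvgM h (cvg_cst (ln (2 : R))^-1).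
  by rewrite subr0 mul1r; apply.
apply: (squeeze_cvgr _ lower); last exact: cvg_cst.
near=> n.
have n2 : (2 <= n)%N by near: n; exact: nbhs_infty_ge.
have n0 : (0 < n)%N by exact: leq_trans n2.
set k := trunc_log 2 n.
have k0 : (0 : R) < k%:R by rewrite ltr0n trunc_log_gt0.
have kn : k%:R * ln 2 <= ln (n%:R : R).
  rewrite mulr_natl -lnXn// -natrX ler_ln ?posrE ?ltr0n ?expn_gt0//.
  by rewrite ler_nat trunc_logP.
have nk : ln (n%:R : R) <= k.+1%:R * ln 2.
  rewrite mulr_natl -lnXn// -natrX ler_ln ?posrE ?ltr0n ?expn_gt0//.
  by rewrite ler_nat ltnW// trunc_log_ltn.
have lnn0 : 0 < ln (n%:R : R) by apply: lt_le_trans kn; rewrite mulr_gt0.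
apply/andP; split.
  rewrite ler_pdivlMr// mulrAC ler_pdivrMr//.
  have -> : 1 - k.+1%:R^-1 = k%:R / k.+1%:R :> R.
    by rewrite -natr1; field; rewrite natr1 pnatr_eq0.
  rewrite mulrAC ler_pdivrMr ?ltr0n// -mulrA ler_pM2l//.
  by rewrite mulrC.
by rewrite ler_pdivrMr// mulrC ler_pdivlMr.
Unshelve. all: by end_near. Qed.

(** Along powers of 2 this is the mean of the increments; a general n lies
    between two consecutive powers of 2, and monotonicity bounds [v n] by the
    values there. *)
Lemma cvg_log_rate (R : realType) (v : nat -> R) (l : R) :
  (forall m n, (0 < m)%N -> (m <= n)%N -> v n <= v m) ->
  v (2 * n)%N - v n @[n --> \oo] --> l ->
  v n / ln n%:R @[n --> \oo] --> l / ln 2.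
Proof.
move=> v_ni vl.
pose w k := v (2 ^ k)%N.
have wl : w k.+1 - w k @[k --> \oo] --> l.
  rewrite /w; under eq_cvg do rewrite expnS.
  apply: (cvg_comp _ _ _ vl) => A [N _ NA].
  exists N => // k /= Nk; apply: NA => /=.
  by rewrite (leq_trans Nk)// ltnW// ltn_expl.
have w0 := cvg_mean_of_increments wl.
have w1 : w k.+1 / k%:R @[k --> \oo] --> l.
  have -> : (fun k => w k.+1 / k%:R) =
      (fun k => w k / k%:R + (w k.+1 - w k) * k%:R^-1).
    by apply/funext => k; rewrite mulrBl addrC subrK.
  rewrite -[l]addr0 -[X in _ --> _ + X](mulr0 l).
  by apply: (@cvgD _ R^o) => //; apply: cvgM => //; exact: cvg_invn.
have vk : v n / (trunc_log 2 n)%:R @[n --> \oo] --> l.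
  have upper := cvg_comp _ _ (trunc_log_cvgy (ltnSn 1)) w0.
  apply: (squeeze_cvgr _ (cvg_comp _ _ (trunc_log_cvgy (ltnSn 1)) w1) upper).
  near=> n.
  have n2 : (2 <= n)%N by near: n; exact: nbhs_infty_ge.
  have n0 : (0 < n)%N by exact: leq_trans n2.
  rewrite /= !ler_pM2r ?invr_gt0 ?ltr0n ?trunc_log_gt0//.
  rewrite !v_ni ?expn_gt0 ?trunc_logP// ltnW//.
  by rewrite trunc_log_ltn.
apply: cvg_trans (cvgM vk (@cvg_trunc_log_ln R)).
apply: near_eq_cvg; near=> n.
have n2 : (2 <= n)%N by near: n; exact: nbhs_infty_ge.
by rewrite /= mulrA divfK// pnatr_eq0 -lt0n trunc_log_gt0.
Unshelve. all: by end_near. Qed.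

(** * Expectations of bounded random variables *)

Section bounded_expectation.
Context d (T : measurableType d) (R : realType) (P : probability T R).

(** Layer cake: both expectations are integrals of the tails over [0, +oo). *)
Lemma le_expectation_of_tails (U V : T -> R) :
  measurable_fun [set: T] U -> measurable_fun [set: T] V ->
  (forall w, 0 <= U w) -> (forall w, 0 <= V w) ->
  (forall r : R, 0 <= r ->
    (P [set w | (r < U w)%R] <= P [set w | (r < V w)%R])%E) ->
  ('E_P[U] <= 'E_P[V])%E.
Proof.
move=> mU mV U0 V0 tails.
pose U' : {RV P >-> R} := mfun_Sub (mem_set mU).
pose V' : {RV P >-> R} := mfun_Sub (mem_set mV).
have ccdfE (W : {RV P >-> R}) r : ccdf W r = P [set w | (r < W w)%R].
  congr (P _); apply/seteqP; split => w /=; rewrite in_itv /= andbT//.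
rewrite (@ge0_expectation_ccdf _ _ _ _ U')//.
rewrite (@ge0_expectation_ccdf _ _ _ _ V')//.
apply: ge0_le_integral => //.
- exact: (measurable_funS measurableT (@subsetT _ _) (ccdf_measurable U')).
- exact: (measurable_funS measurableT (@subsetT _ _) (ccdf_measurable V')).
- by move=> r /=; rewrite in_itv/= andbT !ccdfE => /tails.
Qed.

Lemma Lfun1_of_bounded (U : T -> R) (M : R) :
  measurable_fun [set: T] U -> (forall w, 0 <= U w <= M) -> U \in Lfun P 1.
Proof.
move=> mU UM; apply/Lfun1_integrable.
apply: measurable_bounded_integrable => //; first exact: fin_num_fun_lty.
exists M; split; first exact: num_real.
move=> M' MM' w _ /=; have /andP[U0 UM'] := UM w.
by rewrite ger0_norm// (le_trans UM')// ltW.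
Qed.

Lemma measurable_superlevel (U : T -> R) (r : R) :
  measurable_fun [set: T] U -> measurable [set w | r < U w].
Proof.
move=> mU; have := mU measurableT `]r, +oo[%classic (measurable_itv _).
rewrite setTI; congr measurable; apply/seteqP; split => w /=;
  by rewrite in_itv/= andbT.
Qed.

Lemma indic_Lfun1 (A : set T) : measurable A -> (\1_A : T -> R) \in Lfun P 1.
Proof.
move=> mA; apply: (@Lfun1_of_bounded _ 1); first exact: measurable_indic.
by move=> w; rewrite indicE; case: (_ \in _); rewrite ?lexx ler01.
Qed.

(** Pointwise, U is at most its truncation at delta plus M on the event
    [delta < U]. *)
Lemma expectation_le_truncated (U : T -> R) (M delta : R) :
  measurable_fun [set: T] U -> 0 <= M -> (forall w, 0 <= U w <= M) ->
  0 <= delta ->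
  fine 'E_P[U] <= fine 'E_P[fun w => Num.min (U w) delta] +
    M * fine (P [set w | delta < U w]).
Proof.
move=> mU M0 UM delta0.
have mA := measurable_superlevel delta mU.
set A := [set w | _] in mA *.
have m1 : measurable_fun [set: T] (\1_A : T -> R) by exact: measurable_indic.
have mmin : measurable_fun [set: T] (fun w => Num.min (U w) delta).
  exact: measurable_minr.
have min_M w : 0 <= Num.min (U w) delta <= M.
  have /andP[U0 UM'] := UM w.
  by rewrite le_min U0 delta0 /= ge_min UM'.
have L1 := indic_Lfun1 mA.
have Lmin := Lfun1_of_bounded mmin min_M.
have LU := Lfun1_of_bounded mU UM.
have : ('E_P[U] <= 'E_P[(fun w => Num.min (U w) delta) \+ (M \o* \1_A)])%E.
  apply: expectation_le => //.
  - by apply: measurable_funD => //; apply: measurable_funM.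
  - by move=> w; case/andP: (UM w).
  - move=> w /=; rewrite addr_ge0 ?mulr_ge0//; by case/andP: (min_M w).
  - apply: aeW => w /=; rewrite indicE; have /andP[U0 UM'] := UM w.
    have [wA|wA] := boolP (w \in A).
      by rewrite mul1r; have /andP[? _] := min_M w; lra.
    move: wA; rewrite notin_setE /A /= => /negP; rewrite -leNgt => Ud.
    by rewrite mul0r addr0 le_min lexx.
rewrite expectationD ?Lfun_scale// expectationZl// expectation_indic//.
have PA : P A \is a fin_num by exact: fin_num_measure.
rewrite -(fineK PA) -(fineK (expectation_fin_num LU)).
rewrite -(fineK (expectation_fin_num Lmin)).
by rewrite -EFinM -EFinD lee_fin.
Qed.

Lemma markov_ge0 (U : T -> R) (M eta : R) :
  measurable_fun [set: T] U -> (forall w, 0 <= U w <= M) -> 0 < eta ->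
  eta * fine (P [set w | eta < U w]) <= fine 'E_P[U].
Proof.
move=> mU UM eta0.
have mA := measurable_superlevel eta mU.
set A := [set w | _] in mA *.
have PA : P A \is a fin_num by exact: fin_num_measure.
have LU := Lfun1_of_bounded mU UM.
have L1 := indic_Lfun1 mA.
have m1 : measurable_fun [set: T] (\1_A : T -> R) by exact: measurable_indic.
have : ('E_P[eta \o* (\1_A : T -> R)] <= 'E_P[U])%E.
  apply: expectation_le => //.
  - by apply: measurable_funM => //; exact: measurable_cst.
  - by move=> w /=; rewrite mulr_ge0// ltW.
  - by move=> w; case/andP: (UM w).
  - apply: aeW => w /=; rewrite indicE; have /andP[U0 UM'] := UM w.
    have [wA|wA] := boolP (w \in A); last by rewrite mul0r.
    by rewrite mul1r ltW//; move: wA; rewrite inE.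
rewrite expectationZl// expectation_indic//.
by rewrite -(fineK PA) -(fineK (expectation_fin_num LU)) -EFinM lee_fin.
Qed.

End bounded_expectation.

(** * The sample maximum *)

Section sample_maximum.
Context d (T : measurableType d) (R : realType) (P : probability T R).
Variable X : nat -> {RV P >-> R}.

Lemma measurable_sample_max (n : nat) :
  measurable_fun [set: T] (sample_max X n).
Proof.
rewrite /sample_max; elim: (index_iota 1 n.+1) => [|i s IHs].
  by under eq_fun do rewrite big_nil; exact: measurable_funPT.
under eq_fun do rewrite big_cons.
by apply: measurable_maxr => //; exact: measurable_funPT.
Qed.

Lemma le_sample_max (n i : nat) (w : T) : (1 <= i <= n)%N ->
  X i w <= sample_max X n w.
Proof.
move=> i1n; rewrite /sample_max.
apply: (@le_bigmax_seq _ _ _ _ _ i xpredT (fun i => X i w)) => //.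
by rewrite mem_index_iota ltnS.
Qed.

Lemma sample_max_ltP (n : nat) (t : R) (w : T) : (0 < n)%N ->
  sample_max X n w < t <-> forall i, (1 <= i <= n)%N -> X i w < t.
Proof.
move=> n0; split=> [+ i /le_sample_max Xi|Xt]; first exact: le_lt_trans.
rewrite /sample_max big_seq; apply: bigmax_lt => [|i]; first by rewrite Xt.
by rewrite mem_index_iota ltnS => /Xt.
Qed.

Lemma sample_max_leP (n : nat) (t : R) (w : T) : (0 < n)%N ->
  sample_max X n w <= t <-> forall i, (1 <= i <= n)%N -> X i w <= t.
Proof.
move=> n0; split=> [+ i /le_sample_max Xi|Xt]; first exact: le_trans.
rewrite /sample_max big_seq; apply: bigmax_le => [|i]; first by rewrite Xt.
by rewrite mem_index_iota ltnS => /Xt.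
Qed.

Lemma le_sample_max_size (m n : nat) (w : T) : (0 < m)%N -> (m <= n)%N ->
  sample_max X m w <= sample_max X n w.
Proof.
move=> m0 mn; apply/sample_max_leP => // i /andP[i1 im].
by apply: le_sample_max; rewrite i1 (leq_trans im).
Qed.

Hypothesis Xindep : mutually_independent X.
Hypothesis Xid : identically_distributed X.

Lemma prob_sample_max_lt (n : nat) (t : R) : (0 < n)%N ->
  P [set w | sample_max X n w < t] =
    (fine (P [set w | X 0 w < t]) ^+ n)%:E.
Proof.
move=> n0.
have mt : measurable (`]-oo, t[%classic : set R) by exact: measurable_itv.
have XltE i : P (X i @^-1` `]-oo, t[) = P [set w | X 0 w < t].
  rewrite [LHS](Xid i 0 mt) /distribution /pushforward.
  by congr (P _); apply/seteqP; split => w /=; rewrite in_itv.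
have -> : [set w | sample_max X n w < t] =
    \bigcap_(i in [set` index_iota 1 n.+1]) (X i @^-1` `]-oo, t[).
  apply/seteqP; split => w /=.
    move=> /(sample_max_ltP _ _ n0) Xt i /=; rewrite mem_index_iota ltnS => i1n.
    by rewrite in_itv/= Xt.
  move=> Xt; apply/sample_max_ltP => // i i1n.
  have := Xt i; rewrite /= mem_index_iota ltnS in_itv; exact.
rewrite (Xindep (iota_uniq _ _) (fun=> mt)).
have fP : P [set w | X 0 w < t] \is a fin_num.
  rewrite -(XltE 0%N); apply: fin_num_measure.
  by rewrite -[X in measurable X]setTI; exact: measurable_funPT.
under eq_bigr do rewrite XltE.
rewrite -(fineK fP) /= prodEFin big_const_seq count_predT size_iota subSS subn0.
by rewrite iter_mulr_1.
Qed.

(** * The shortfall of the maximum below the endpoint *)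
Variables (xstar x : R).
Hypothesis x_lt : x < xstar.

(** Unlike [xstar - Num.max (sample_max X n w) x], this is nonnegative
    everywhere, not only almost surely. *)
Definition shortfall (n : nat) (w : T) : R :=
  Num.max (xstar - Num.max (sample_max X n w) x) 0.

(** The strict inequality matches the event [r < shortfall n w] exactly; a
    distribution function would give its closure. *)
Definition below_endpoint_prob (u : R) : R :=
  fine (P [set w | X 0 w < xstar - u]).

Lemma measurable_shortfall (n : nat) : measurable_fun [set: T] (shortfall n).
Proof.
apply: measurable_maxr => //; apply: measurable_funB => //.
by apply: measurable_maxr => //; exact: measurable_sample_max.
Qed.

Lemma shortfall_bounds (n : nat) (w : T) : 0 <= shortfall n w <= xstar - x.
Proof.
rewrite /shortfall le_max lexx orbT /= ge_max subr_ge0 (ltW x_lt) andbT.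
by rewrite lerD2l lerN2 le_max lexx orbT.
Qed.

Lemma shortfall_tail (n : nat) (r : R) : (0 < n)%N -> 0 <= r < xstar - x ->
  P [set w | r < shortfall n w] = (below_endpoint_prob r ^+ n)%:E.
Proof.
move=> n0 /andP[r0 rL]; rewrite -prob_sample_max_lt//.
congr (P _); apply/seteqP; split => w /=; rewrite /shortfall.
  by rewrite lt_max [r < 0]ltNge r0 orbF ltrBrDl -ltrBrDr gt_max => /andP[].
by move=> Zr; rewrite lt_max ltrBrDl -ltrBrDr gt_max Zr /=; lra.
Qed.

End sample_maximum.

Section shortfall_mean.
Context d (T : measurableType d) (R : realType) (P : probability T R).
Variables (X : nat -> {RV P >-> R}) (xstar x : R).
Hypothesis Xindep : mutually_independent X.
Hypothesis Xid : identically_distributed X.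
Hypothesis x_lt : x < xstar.

Let k := below_endpoint_prob X xstar.
Let Y := shortfall X xstar x.
Let L := xstar - x.

Definition shortfall_mean (n : nat) : R := fine 'E_P[shortfall X xstar x n].
Let J := shortfall_mean.

Let L_gt0 : 0 < L. Proof. by rewrite subr_gt0. Qed.

Let Y_bounds n w : 0 <= Y n w <= L.
Proof. exact: shortfall_bounds. Qed.

Let mY n : measurable_fun [set: T] (Y n).
Proof. exact: measurable_shortfall. Qed.

Let mminY n delta : measurable_fun [set: T] (fun w => Num.min (Y n w) delta).
Proof. by apply: measurable_minr => //; exact: measurable_cst. Qed.

Let minY_bounds n delta w : 0 <= delta -> 0 <= Num.min (Y n w) delta <= L.
Proof.
move=> delta0; have /andP[Y0 YL] := Y_bounds n w.
by rewrite le_min Y0 delta0 /= ge_min YL.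
Qed.

Let EY n : ('E_P[Y n] = (J n)%:E)%E.
Proof.
rewrite fineK//; apply: expectation_fin_num.
by apply: Lfun1_of_bounded (Y_bounds n).
Qed.

Let tailY n r : (0 < n)%N -> 0 <= r < L ->
  P [set w | r < Y n w] = (k r ^+ n)%:E.
Proof. exact: shortfall_tail. Qed.

Let J_truncated n delta : (0 < n)%N -> 0 <= delta < L ->
  J n <= fine 'E_P[fun w => Num.min (Y n w) delta] + L * k delta ^+ n.
Proof.
move=> n0 deltaL; have delta0 : 0 <= delta by case/andP: deltaL.
have := expectation_le_truncated P (mY n) (ltW L_gt0) (Y_bounds n) delta0.
by rewrite tailY.
Qed.

(** The hypothesis on k says that the tail of [lam * min (Y_n, delta)] is
    dominated by that of [Y_{cn}]. *)
Lemma shortfall_mean_dilate_ge (c n : nat) (lam delta : R) :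
  (0 < c)%N -> (0 < n)%N -> 0 < lam <= 1 -> 0 < delta < L ->
  (forall u, 0 <= u < delta -> k u <= k (lam * u) ^+ c) ->
  lam * (J n - L * k delta ^+ n) <= J (c * n)%N.
Proof.
move=> c0 n0 /andP[lam0 lam1] /andP[delta0 deltaL] k_le.
have cn0 : (0 < c * n)%N by rewrite muln_gt0 c0.
pose U := fun w => Num.min (Y n w) delta.
have LU : U \in Lfun P 1.
  apply: (@Lfun1_of_bounded _ _ _ _ _ L) => [|w]; first exact: mminY.
  by apply: minY_bounds; exact: ltW.
have : ('E_P[lam \o* U] <= 'E_P[Y (c * n)%N])%E.
  apply: le_expectation_of_tails => //.
  - by apply: measurable_funM => //; exact: mminY.
  - move=> w /=; rewrite mulr_ge0 ?(ltW lam0)//.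
    by case/andP: (minY_bounds n w (ltW delta0)).
  - by move=> w; case/andP: (Y_bounds (c * n) w).
  - move=> r r0.
    have [rd|rd] := leP (lam * delta) r.
      rewrite (_ : [set _ | _] = set0) ?measure0//.
      apply/seteqP; split => w //=; rewrite mulrC => /(le_lt_trans rd).
      by rewrite ltr_pM2l// /U lt_min ltxx andbF.
    have rlam : 0 <= r / lam < delta.
      by rewrite divr_ge0 ?(ltW lam0)//= ltr_pdivrMr// mulrC.
    have rL : r < L.
      apply: lt_trans rd _; apply: le_lt_trans deltaL.
      by rewrite ler_piMl// ltW.
    rewrite (_ : [set w | r < _] = [set w | r / lam < Y n w]).
      rewrite !tailY ?r0//; last by case/andP: rlam => -> /= /lt_trans; apply.
      rewrite lee_fin exprM lerXn2r ?nnegrE ?exprn_ge0 ?fine_ge0//.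
      by have := k_le _ rlam; rewrite [lam * _]mulrC divfK// gt_eqF.
    apply/seteqP; split => w /=; rewrite -ltr_pdivrMr// /U lt_min.
      by case/andP.
    by move=> ->; case/andP: rlam.
rewrite expectationZl// EY -(fineK (expectation_fin_num LU)) -EFinM lee_fin.
apply: le_trans; rewrite ler_pM2l// lerBlDr.
by apply: J_truncated => //; rewrite (ltW delta0).
Qed.

(** Here the tail of [min (Y_{cn}, lam * delta)] is dominated by that of
    [lam * Y_n]. *)
Lemma shortfall_mean_dilate_le (c n : nat) (lam delta : R) :
  (0 < c)%N -> (0 < n)%N -> 0 < lam -> 0 < delta <= L -> lam * delta < L ->
  (forall u, 0 <= u < delta -> k (lam * u) ^+ c <= k u) ->
  J (c * n)%N <= lam * J n + L * k (lam * delta) ^+ (c * n).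
Proof.
move=> c0 n0 lam0 /andP[delta0 deltaL] lamdL k_ge.
have cn0 : (0 < c * n)%N by rewrite muln_gt0 c0.
have ld0 : 0 < lam * delta by rewrite mulr_gt0.
pose U := fun w => Num.min (Y (c * n) w) (lam * delta).
have LU : U \in Lfun P 1.
  apply: (@Lfun1_of_bounded _ _ _ _ _ L) => [|w]; first exact: mminY.
  by apply: minY_bounds; exact: ltW.
have LY : Y n \in Lfun P 1 by exact: Lfun1_of_bounded (Y_bounds n).
have : ('E_P[U] <= 'E_P[lam \o* Y n])%E.
  apply: le_expectation_of_tails => //.
  - exact: mminY.
  - by apply: measurable_funM.
  - by move=> w; case/andP: (minY_bounds (c * n) w (ltW ld0)).
  - by move=> w /=; rewrite mulr_ge0 ?(ltW lam0)//; case/andP: (Y_bounds n w).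
  - move=> r r0.
    have [rd|rd] := leP (lam * delta) r.
      rewrite (_ : [set _ | _] = set0) ?measure0//.
      apply/seteqP; split => w //= /(le_lt_trans rd).
      by rewrite /U lt_min ltxx andbF.
    have rlam : 0 <= r / lam < delta.
      by rewrite divr_ge0 ?(ltW lam0)//= ltr_pdivrMr// mulrC.
    rewrite (_ : [set w | r < U w] = [set w | r < Y (c * n) w]); last first.
      by apply/seteqP; split => w /=; rewrite /U lt_min rd andbT.
    rewrite (_ : [set w | r < (lam \o* Y n) w] = [set w | r / lam < Y n w]);
      last first.
      by apply/seteqP; split => w /=; rewrite ltr_pdivrMr.
    rewrite !tailY ?r0//=; last 2 first.
    + by case/andP: rlam => -> /= /lt_le_trans; apply.
    + by rewrite (lt_trans rd).
    rewrite lee_fin exprM lerXn2r ?nnegrE ?exprn_ge0 ?fine_ge0//.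
    by have := k_ge _ rlam; rewrite [lam * _]mulrC divfK// gt_eqF.
rewrite expectationZl// EY -(fineK (expectation_fin_num LU)).
rewrite -EFinM lee_fin => UY.
have ldL : 0 <= lam * delta < L by rewrite (ltW ld0).
by apply: (le_trans (J_truncated cn0 ldL)); rewrite lerD2r.
Qed.

Lemma shortfall_mean_ge (n : nat) (eta : R) : (0 < n)%N -> 0 < eta < L ->
  eta * k eta ^+ n <= J n.
Proof.
move=> n0 /andP[eta0 etaL].
have := markov_ge0 P (mY n) (Y_bounds n) eta0.
by rewrite tailY// (ltW eta0).
Qed.

Lemma shortfall_mean_ni (m n : nat) : (0 < m)%N -> (m <= n)%N -> J n <= J m.
Proof.
move=> m0 mn; rewrite -lee_fin -!EY; apply: expectation_le => //.
- by move=> w; case/andP: (Y_bounds n w).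
- by move=> w; case/andP: (Y_bounds m w).
apply: aeW => w; rewrite /Y /shortfall.
have := le_sample_max_size X w m0 mn => Zmn.
have : Num.max (sample_max X m w) x <= Num.max (sample_max X n w) x.
  by rewrite ge_max !le_max Zmn lexx orbT.
move=> maxmn; rewrite ge_max !le_max lexx orbT andbT.
by rewrite lerD2l lerN2 maxmn.
Qed.

End shortfall_mean.

(** * The distribution function at its right endpoint *)

Section distribution_at_endpoint.
Context d (T : measurableType d) (R : realType) (P : probability T R).
Variables (Z : {RV P >-> R}) (xstar : R).
Let F := distribution_function Z.

Let cdfE t : cdf Z t = (F t)%:E.
Proof. by rewrite /F /distribution_function fineK// fin_num_measure. Qed.

Lemma distribution_function_nd : {homo F : s t / s <= t}.
Proof.
by move=> s t st; rewrite -lee_fin -!cdfE; exact: cdf_nondecreasing.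
Qed.

Lemma distribution_function_bounds (t : R) : 0 <= F t <= 1.
Proof. by rewrite -!lee_fin -cdfE cdf_ge0 cdf_le1. Qed.

Hypothesis xstarE : right_endpoint F = xstar%:E.

Lemma lt1_below_endpoint (t : R) : t < xstar -> F t < 1.
Proof.
rewrite -lte_fin -xstarE => /ereal_sup_gt[_ [s [_ Fs1] <-]].
rewrite lte_fin => /ltW ts.
exact: le_lt_trans (distribution_function_nd ts) Fs1.
Qed.

(** F is 1 strictly above the endpoint by maximality, hence also at it by right
    continuity. *)
Lemma eq1_at_endpoint : 0 < xstar -> F xstar = 1.
Proof.
move=> xstar0; apply: EFin_inj; rewrite -cdfE.
have above t : xstar < t -> cdf Z t = 1%:E.
  move=> xt; rewrite cdfE; congr EFin; apply/eqP; rewrite eq_le.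
  have /andP[_ ->] /= := distribution_function_bounds t.
  rewrite leNgt; apply/negP => Ft1.
  have : (t%:E <= right_endpoint F)%E.
    by apply: ereal_sup_ubound; exists t => //; split => //; lra.
  by rewrite xstarE lee_fin leNgt xt.
have h := cdf_right_continuous (X := Z) (x := xstar).
apply: (cvg_unique _ h) => //.
apply: cvg_near_cst; near=> t; apply: above.
by near: t; exact: nbhs_right_gt.
Unshelve. all: by end_near. Qed.

Lemma ae_le_endpoint (Z' : {RV P >-> R}) : 0 < xstar ->
  (forall A : set R, measurable A ->
    distribution P Z' A = distribution P Z A) ->
  {ae P, forall w, Z' w <= xstar}.
Proof.
move=> xstar0 same.
exists (Z' @^-1` `]xstar, +oo[); split.
- by rewrite -[X in measurable X]setTI; exact: measurable_funPT.
- have -> : P (Z' @^-1` `]xstar, +oo[) = ccdf Z xstar by exact: same.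
  have ccdf_fin : ccdf Z xstar \is a fin_num by exact: fin_num_measure.
  have := cdf_ccdf_1 Z xstar; rewrite cdfE eq1_at_endpoint// -(fineK ccdf_fin).
  by rewrite -EFinD => -[] /eqP; rewrite -[eqbRHS]addr0 => /eqP/addrI ->.
- by move=> w /= /negP; rewrite -ltNge in_itv/= andbT.
Qed.

End distribution_at_endpoint.

(** * Asymptotics of the mean shortfall *)
Section shortfall_asymptotics.
Context d (T : measurableType d) (R : realType) (P : probability T R).
Variables (X : nat -> {RV P >-> R}) (xstar xi : R).
Let F := distribution_function (X 0).
Let k := below_endpoint_prob X xstar.
Hypothesis Xindep : mutually_independent X.
Hypothesis Xid : identically_distributed X.
Hypothesis xstarE : right_endpoint F = xstar%:E.
Hypothesis xstar_gt0 : 0 < xstar.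
Hypothesis FMDA : MDA F (gev xi).
Hypothesis xi_le0 : xi <= 0.

Let mlt t : measurable [set w | X 0 w < t].
Proof.
rewrite (_ : [set w | _] = X 0%N @^-1` `]-oo, t[).
  by rewrite -[X in measurable X]setTI; exact: measurable_funPT.
by apply/seteqP; split => w /=; rewrite in_itv.
Qed.

Let mle t : measurable [set w | X 0 w <= t].
Proof.
rewrite (_ : [set w | _] = X 0%N @^-1` `]-oo, t]).
  by rewrite -[X in measurable X]setTI; exact: measurable_funPT.
by apply/seteqP; split => w /=; rewrite in_itv.
Qed.

Let FE t : F t = fine (P [set w | X 0 w <= t]).
Proof.
congr (fine (P _)); by apply/seteqP; split => w /=; rewrite in_itv.
Qed.

Lemma below_endpoint_prob_le_cdf (u : R) : k u <= F (xstar - u).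
Proof.
rewrite FE /k /below_endpoint_prob fine_le ?fin_num_measure//.
by apply: le_measure; rewrite ?inE// => w /=; exact: ltW.
Qed.

Lemma cdf_le_below_endpoint_prob (s u : R) : u < s -> F (xstar - s) <= k u.
Proof.
move=> us; rewrite FE /k /below_endpoint_prob fine_le ?fin_num_measure//.
apply: le_measure; rewrite ?inE// => w /= /le_lt_trans; apply.
by rewrite ltrD2l ltrN2.
Qed.

Lemma below_endpoint_prob_bounds (u : R) : 0 <= k u <= 1.
Proof.
rewrite fine_ge0//= -lee_fin fineK ?fin_num_measure//.
exact: probability_le1.
Qed.

Let F_nd : {homo F : s t / s <= t}.
Proof. exact: distribution_function_nd. Qed.

Let F01 t : 0 <= F t <= 1.
Proof. exact: distribution_function_bounds. Qed.

Let F_lt1 t : t < xstar -> F t < 1.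
Proof. exact: lt1_below_endpoint. Qed.

Let F_eq1 : F xstar = 1.
Proof. exact: eq1_at_endpoint. Qed.

Lemma below_endpoint_prob_near1 (y : R) : y < 1 -> 
  exists2 eta, 0 < eta & forall u, u < eta -> y < k u.
Proof.
move=> y1; have [a [b [a0 ab]]] := FMDA.
have [eta eta0 yeta] := cdf_close_to_1 xi_le0 F_nd F01 F_eq1 ab y1.
exists eta => // u ueta.
exact: lt_le_trans yeta (cdf_le_below_endpoint_prob ueta).
Qed.

Lemma below_endpoint_prob0 : k 0 = 1.
Proof.
apply/eqP; rewrite eq_le; have /andP[_ ->] /= := below_endpoint_prob_bounds 0.
rewrite leNgt; apply/negP => /below_endpoint_prob_near1[eta eta0 /(_ 0 eta0)].
by rewrite ltxx.
Qed.

Lemma below_endpoint_prob_lt1 (u : R) : 0 < u -> k u < 1.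
Proof.
move=> u0; apply: le_lt_trans (below_endpoint_prob_le_cdf u) _.
by apply: F_lt1; lra.
Qed.

(** Passing from P(X <= .) to P(X < .) costs an arbitrarily small change of
    lam, which the strict inequality between lam and [c `^ xi] absorbs. *)
Lemma below_endpoint_prob_le_dilated (c : nat) (lam : R) :
  (0 < c)%N -> 0 < lam < c%:R `^ xi ->
  exists2 delta, 0 < delta &
    forall u, 0 <= u < delta -> k u <= k (lam * u) ^+ c.
Proof.
move=> c0 /andP[lam0 lamc]; have [a [b [a0 ab]]] := FMDA.
pose mu := (lam + c%:R `^ xi) / 2.
have mu_between : 0 < mu < c%:R `^ xi by rewrite /mu; lra.
have lam_mu : lam < mu by rewrite /mu; lra.
have [delta delta0 Fdelta] :=
  cdf_le_dilated_power xi_le0 a0 F_nd F01 F_lt1 F_eq1 ab c0 mu_between.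
exists delta => // u /andP[]; rewrite le_eqVlt => /predU1P[<- _|u0 ud].
  by rewrite mulr0 below_endpoint_prob0 expr1n.
apply: le_trans (below_endpoint_prob_le_cdf u) _.
apply: (le_trans (Fdelta u _)); first by rewrite u0.
rewrite lerXn2r ?nnegrE//.
- by case/andP: (F01 (xstar - mu * u)).
- by case/andP: (below_endpoint_prob_bounds (lam * u)).
- by apply: cdf_le_below_endpoint_prob; rewrite ltr_pM2r.
Qed.

Lemma below_endpoint_prob_dilated_le (c : nat) (lam : R) :
  (0 < c)%N -> c%:R `^ xi < lam ->
  exists2 delta, 0 < delta &
    forall u, 0 <= u < delta -> k (lam * u) ^+ c <= k u.
Proof.
move=> c0 lamc; have [a [b [a0 ab]]] := FMDA.
pose mu := (lam + c%:R `^ xi) / 2.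
have g0 : 0 <= c%:R `^ xi by exact: powR_ge0.
have mu_c : c%:R `^ xi < mu by rewrite /mu; lra.
have mu0 : 0 < mu by lra.
have mu_lam : mu < lam by rewrite /mu; lra.
have [delta delta0 Fdelta] :=
  dilated_power_le_cdf xi_le0 a0 F_nd F01 F_lt1 F_eq1 ab c0 mu_c.
have lam0 : 0 < lam by lra.
exists (delta * mu / lam); first by apply: divr_gt0 => //; exact: mulr_gt0.
move=> u /andP[]; rewrite le_eqVlt => /predU1P[<- _|u0 ud].
  by rewrite mulr0 below_endpoint_prob0 expr1n.
(* v exceeds u and satisfies [mu * v = lam * u]. *)
pose v := lam * u / mu.
have v0 : 0 < v by apply: divr_gt0 => //; exact: mulr_gt0.
have vd : v < delta.
  by rewrite ltr_pdivrMr// mulrC -ltr_pdivlMr.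
have uv : u < v by rewrite /v ltr_pdivlMr// mulrC ltr_pM2r.
have muv : mu * v = lam * u by rewrite mulrC divfK ?gt_eqF.
apply: le_trans (cdf_le_below_endpoint_prob uv).
apply: le_trans (Fdelta v _); last by rewrite v0.
rewrite muv lerXn2r ?nnegrE ?below_endpoint_prob_le_cdf//.
- by case/andP: (below_endpoint_prob_bounds (lam * u)).
- by case/andP: (F01 (xstar - lam * u)).
Qed.

Variable x : R.
Hypothesis x_lt : x < xstar.
Let L := xstar - x.
Let J := shortfall_mean X xstar x.
Let L_gt0 : 0 < L. Proof. by rewrite subr_gt0. Qed.

(** Markov's inequality at a level eta so small that P(X < xstar - eta)
    exceeds y. *)
Lemma shortfall_mean_gt_geometric (y : R) : 0 <= y < 1 ->
  exists eta z, [/\ 0 < eta, y < z &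
    forall n, (0 < n)%N -> eta * z ^+ n <= J n].
Proof.
move=> /andP[y0 y1].
have [eta eta0 yeta] := below_endpoint_prob_near1 y1.
pose eta' := Num.min eta L / 2.
have eta'0 : 0 < eta' by rewrite divr_gt0// lt_min eta0.
have lt_eta' : eta' < Num.min eta L by move: eta'0; rewrite /eta'; lra.
move: (lt_eta'); rewrite lt_min => /andP[eta'_eta eta'L].
exists eta', (k eta'); split => //; first exact: yeta.
by move=> n n0; apply: shortfall_mean_ge; rewrite ?eta'0.
Qed.

Lemma shortfall_mean_gt0 (n : nat) : (0 < n)%N -> 0 < J n.
Proof.
move=> n0.
have zero01 : 0 <= (0 : R) < 1 by rewrite lexx ltr01.
have [eta [z [eta0 z0 Jge]]] := shortfall_mean_gt_geometric zero01.
by apply: lt_le_trans (Jge n n0); rewrite mulr_gt0 ?exprn_gt0.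
Qed.

Lemma geometric_negligible (y : R) : 0 <= y < 1 ->
  y ^+ n / J n @[n --> \oo] --> (0 : R).
Proof.
move=> y01; have [eta [z [eta0 yz Jge]]] := shortfall_mean_gt_geometric y01.
have y0 : 0 <= y by case/andP: y01.
have z0 : 0 < z by lra.
have yz1 : `|y / z| < 1 by rewrite ger0_norm ?ltr_pdivrMr ?mul1r// divr_ge0// ltW.
have upper : eta^-1 * (y / z) ^+ n @[n --> \oo] --> (0 : R).
  by rewrite -(mulr0 eta^-1); apply: cvgM; [exact: cvg_cst|exact: cvg_expr].
apply: (squeeze_cvgr _ (cvg_cst 0) upper).
near=> n.
have n0 : (0 < n)%N by near: n; exact: nbhs_infty_ge.
have J0 := shortfall_mean_gt0 n0.
rewrite divr_ge0 ?exprn_ge0 ?(ltW J0)//= ler_pdivrMr//.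
apply: le_trans (ler_wpM2l _ (Jge n n0)).
  by rewrite mulrACA mulVf ?gt_eqF// mul1r -exprMn divfK ?gt_eqF.
by rewrite mulr_ge0 ?exprn_ge0 ?divr_ge0 ?invr_ge0 ?(ltW eta0) ?(ltW z0).
Unshelve. all: by end_near. Qed.

Lemma powR_nat_le1 (c : nat) : (0 < c)%N -> (c%:R : R) `^ xi <= 1.
Proof. by move=> c0; rewrite -[leRHS](powRr0 c%:R) ler_powR// ler1n. Qed.

(** Take lam between l and [c `^ xi]: after division by [J n],
    [shortfall_mean_dilate_ge] bounds the ratio below by lam times
    [1 - L * o(1)]. *)
Lemma shortfall_ratio_gt (c : nat) (l : R) : (0 < c)%N -> l < c%:R `^ xi ->
  \forall n \near \oo, l < J (c * n)%N / J n.
Proof.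
move=> c0 lc.
have g0 : 0 < (c%:R : R) `^ xi by rewrite powR_gt0// ltr0n.
have g1 := powR_nat_le1 c0.
pose lam := (Num.max l 0 + c%:R `^ xi) / 2.
have lt_max : Num.max l 0 < c%:R `^ xi by rewrite gt_max lc.
have l_max : l <= Num.max l 0 by rewrite le_max lexx.
have max0 : 0 <= Num.max l 0 by rewrite le_max lexx orbT.
have lam_between : 0 < lam < c%:R `^ xi by rewrite /lam; lra.
have l_lam : l < lam by rewrite /lam; lra.
have [delta0 delta0_gt0 k_le] := below_endpoint_prob_le_dilated c0 lam_between.
pose delta := Num.min delta0 L / 2.
have min0 : 0 < Num.min delta0 L by rewrite lt_min delta0_gt0.
have : delta < Num.min delta0 L by rewrite /delta; lra.
rewrite lt_min => /andP[delta_delta0 deltaL].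
have delta_gt0 : 0 < delta by rewrite divr_gt0.
have kdelta : 0 <= k delta < 1.
  rewrite below_endpoint_prob_lt1// andbT.
  by case/andP: (below_endpoint_prob_bounds delta).
have lower : lam * (1 - L * (k delta ^+ n / J n)) @[n --> \oo] -->
    lam * (1 - L * 0).
  apply: cvgM; first exact: cvg_cst.
  apply: (@cvgB _ R^o); first exact: cvg_cst.
  by apply: cvgM; [exact: cvg_cst|exact: geometric_negligible].
near=> n.
have n0 : (0 < n)%N by near: n; exact: nbhs_infty_ge.
have J0 := shortfall_mean_gt0 n0.
apply: (@lt_le_trans _ _ (lam * (1 - L * (k delta ^+ n / J n)))).
  by near: n; apply: (cvgr_gt _ lower); rewrite mulr0 subr0 mulr1.
rewrite ler_pdivlMr//.
have -> : lam * (1 - L * (k delta ^+ n / J n)) * J n =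
    lam * (J n - L * k delta ^+ n).
  by field; rewrite gt_eqF.
apply: shortfall_mean_dilate_ge => //.
- by case/andP: lam_between => -> /=; lra.
- by rewrite delta_gt0.
- by move=> u /andP[u0 ud]; apply: k_le; rewrite u0 (lt_trans ud).
Unshelve. all: by end_near. Qed.

Lemma shortfall_ratio_lt (c : nat) (l : R) : (0 < c)%N -> c%:R `^ xi < l ->
  \forall n \near \oo, J (c * n)%N / J n < l.
Proof.
move=> c0 cl.
have g0 : 0 < (c%:R : R) `^ xi by rewrite powR_gt0// ltr0n.
pose lam := (l + c%:R `^ xi) / 2.
have c_lam : c%:R `^ xi < lam by rewrite /lam; lra.
have lam0 : 0 < lam by lra.
have l_lam : lam < l by rewrite /lam; lra.
have [delta0 delta0_gt0 k_ge] := below_endpoint_prob_dilated_le c0 c_lam.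
pose delta := Num.min delta0 (Num.min L (L / lam)) / 2.
have min0 : 0 < Num.min delta0 (Num.min L (L / lam)).
  by rewrite !lt_min delta0_gt0 L_gt0 divr_gt0.
have : delta < Num.min delta0 (Num.min L (L / lam)) by rewrite /delta; lra.
rewrite !lt_min => /and3P[delta_delta0 deltaL delta_lam].
have delta_gt0 : 0 < delta by rewrite divr_gt0.
have kdelta : 0 <= k delta < 1.
  rewrite below_endpoint_prob_lt1// andbT.
  by case/andP: (below_endpoint_prob_bounds delta).
have upper : lam + L * (k delta ^+ n / J n) @[n --> \oo] --> lam + L * 0.
  apply: (@cvgD _ R^o); first exact: cvg_cst.
  by apply: cvgM; [exact: cvg_cst|exact: geometric_negligible].
near=> n.
have n0 : (0 < n)%N by near: n; exact: nbhs_infty_ge.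
have J0 := shortfall_mean_gt0 n0.
apply: (@le_lt_trans _ _ (lam + L * (k delta ^+ n / J n))); last first.
  by near: n; apply: (cvgr_lt _ upper); rewrite mulr0 addr0.
rewrite ler_pdivrMr//.
have -> : (lam + L * (k delta ^+ n / J n)) * J n = lam * J n + L * k delta ^+ n.
  by field; rewrite gt_eqF.
have lamdL : lam * delta < L by rewrite mulrC -ltr_pdivlMr.
have k_ge' u : 0 <= u < delta -> k (lam * u) ^+ c <= k u.
  by move=> /andP[u0 ud]; apply: k_ge; rewrite u0 (lt_trans ud).
have delta_in : 0 < delta <= L by rewrite delta_gt0 ltW.
apply: (le_trans (shortfall_mean_dilate_le Xindep Xid x_lt c0 n0 lam0
  delta_in lamdL k_ge')).
rewrite lerD2l ler_pM2l// exprM lerXn2r ?nnegrE//.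
- by rewrite exprn_ge0//; case/andP: (below_endpoint_prob_bounds (lam * delta)).
- by case/andP: kdelta.
- by apply: k_ge; rewrite (ltW delta_gt0).
Unshelve. all: by end_near. Qed.

Lemma cvg_shortfall_ratio (c : nat) : (0 < c)%N ->
  J (c * n)%N / J n @[n --> \oo] --> c%:R `^ xi.
Proof.
move=> c0; apply/cvgrPdist_lt => /= e e0.
near=> n.
rewrite ltr_distlC; apply/andP; split; near: n.
  by apply: shortfall_ratio_gt => //; lra.
by apply: shortfall_ratio_lt => //; lra.
Unshelve. all: by end_near. Qed.

(** Almost surely no observation exceeds the endpoint, and then taking the
    positive part changes nothing. *)
Lemma expectation_Delta (n : nat) : (0 < n)%N ->
  fine 'E_P[Delta X xstar n x] = J n / xstar.
Proof.
move=> n0.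
have mY : measurable_fun [set: T] (shortfall X xstar x n).
  exact: measurable_shortfall.
have LY : shortfall X xstar x n \in Lfun P 1.
  by apply: (Lfun1_of_bounded P mY) => w; exact: shortfall_bounds.
suff -> : ('E_P[Delta X xstar n x] =
    'E_P[xstar^-1%R \o* shortfall X xstar x n])%E.
  rewrite expectationZl// -(fineK (expectation_fin_num LY)) -EFinM /=.
  by rewrite mulrC.
rewrite unlock; apply: ae_eq_integral => //.
- apply/measurable_EFinP; apply: measurable_funM => //.
  apply: measurable_funB => //; apply: measurable_maxr => //.
  exact: measurable_sample_max.
- by apply/measurable_EFinP; apply: measurable_funM.
have : {ae P, forall w, forall i, X i w <= xstar}.
  apply: ae_foralln => i.
  by apply: (ae_le_endpoint xstarE xstar_gt0) => A mA; exact: Xid.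
apply: filterS => w Xle _; congr EFin.
rewrite /Delta /= /shortfall [in RHS]max_l// subr_ge0 ge_max (ltW x_lt) andbT.
by apply/sample_max_leP.
Qed.

End shortfall_asymptotics.

(* X 0 is the generic variable X; X 1, X 2, ... is the sequence X_1, X_2, ... *)
Theorem proposition3p5 (R : realType) (d : measure_display)
    (T : measurableType d) (P : probability T R) (X : nat -> {RV P >-> R})
    (F : R -> R) (xstar xi : R)
    (Xindep : mutually_independent X)
    (Xid : identically_distributed X)
    (Xge0 : forall i w, 0 <= X i w)
    (FE : F = distribution_function (X 0%N))
    (xstar_fin : right_endpoint F = xstar%:E)
    (xstar_gt0 : 0 < xstar)
    (EX_fin : ('E_P[X 0%N] < +oo)%E)
    (xi_lt1 : xi < 1)
    (FMDA : MDA F (gev xi))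
    (xi_le0 : xi <= 0) :
  (forall (x : R) (c : nat), 0 < x < xstar -> (0 < c)%N ->
     fine 'E_P[Delta X xstar (c * n) x] / fine 'E_P[Delta X xstar n x]
       @[n --> \oo] --> c%:R `^ xi) /\
  (forall x : R, 0 < x < xstar ->
     ln (fine 'E_P[Delta X xstar n x]) / ln n%:R @[n --> \oo] --> xi).
Proof.
subst F.
have ratio (x : R) (c : nat) : x < xstar -> (0 < c)%N ->
    fine 'E_P[Delta X xstar (c * n) x] / fine 'E_P[Delta X xstar n x]
      @[n --> \oo] --> c%:R `^ xi.
  move=> x_lt c0.
  have := cvg_shortfall_ratio Xindep Xid xstar_fin xstar_gt0 FMDA xi_le0
    x_lt c0.
  apply: cvg_trans; apply: near_eq_cvg; near=> n.
  have n0 : (0 < n)%N by near: n; exact: nbhs_infty_ge.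
  rewrite !(expectation_Delta Xid xstar_fin xstar_gt0 x_lt) ?muln_gt0 ?c0//.
  by rewrite invf_div mulrA divfK ?gt_eqF.
split=> [x c /andP[_ x_lt] c0|x /andP[_ x_lt]]; first exact: ratio.
have E_gt0 n : (0 < n)%N -> 0 < fine 'E_P[Delta X xstar n x].
  move=> n0; rewrite (expectation_Delta Xid xstar_fin xstar_gt0 x_lt)//.
  rewrite divr_gt0//.
  exact: (shortfall_mean_gt0 Xindep Xid xstar_fin xstar_gt0 FMDA xi_le0 x_lt n0).
have ln2_gt0 : 0 < ln (2 : R) by apply: ln_gt0; lra.
have -> : xi = ln (2%:R `^ xi) / ln 2.
  by rewrite ln_powR mulfK ?gt_eqF.
apply: (@cvg_log_rate _ (fun n => ln (fine 'E_P[Delta X xstar n x]))).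
  move=> m n m0 mn; rewrite ler_ln ?posrE ?E_gt0 ?(leq_trans m0)//.
  rewrite !(expectation_Delta Xid xstar_fin xstar_gt0 x_lt) ?(leq_trans m0)//.
  by rewrite ler_pM2r ?invr_gt0// shortfall_mean_ni.
have p0 : 0 < (2%:R : R) `^ xi by rewrite powR_gt0.
have := cvg_comp _ _ (ratio x 2%N x_lt isT) (continuous_ln p0).
apply: cvg_trans; apply: near_eq_cvg; near=> n.
have n0 : (0 < n)%N by near: n; exact: nbhs_infty_ge.
by rewrite /= ln_div ?posrE ?E_gt0 ?muln_gt0.
Unshelve. all: by end_near. Qed.
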